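(* If the speed ratio $\alpha$ of the two robots is controlled by an oblivious adversary (and unknown to the algorithm), then, even with zero wait time and zero computation delay, it is improbable for the two robots to gather: for any randomized algorithm, the probability of gathering is zero.
   Context: Two robots are anonymous, oblivious (no memory of past cycles), silent (no communication) points in the Euclidean plane with no common coordinate system, each having access to random bits. Each robot repeatedly executes a cycle: it waits (wait time $\mathcal{W}$), looks (obtains a snapshot of the other robot's current position, which may be in motion), has a computation delay $\mathcal{C}$, then moves at its speed to a destination computed from the snapshot and its random bits, reaching it in the same cycle (rigid movement). By the reduction to the line, an algorithm is described by the fact that at each cycle a robot moves a distance $\lambda\delta$ towards the other robot along the line joining them, where $\delta$ is the observed distance and $\lambda\in\mathbb{R}$ is chosen by the algorithm (possibly at random). A robot that looks and finds the other robot at its own position decides it has gathered and stops; gathering means both robots are at the same point. An oblivious adversary knows the algorithm but not the outcomes of random bits. Here all wait times and computation delays are $0$, and the adversary chooses the speed ratio $\alpha\in(0,\infty)$ of the robots, which the algorithm does not know. ''Improbable'' means the probability of gathering is zero (although the set of gathering outcomes may be nonempty). *)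

(* Defs.v *)
From HB Require Import structures.
From mathcomp Require Import all_boot all_order all_algebra.
From mathcomp Require Import all_classical all_reals all_analysis.
Set Implicit Arguments. Unset Strict Implicit. Unset Printing Implicit Defensive.
Import Order.TTheory GRing.Theory Num.Theory.
Local Open Scope ring_scope.
Local Open Scope classical_set_scope.

(* Two robots on a line (after the paper's reduction to the line), zero wait *)
(* time and zero computation delay.  Robot A has speed v, robot B speed w.   *)
(* At every cycle a robot looks (snapshot of the other robot's current       *)
(* position p), and, if p differs from its own position q, moves rigidly     *)
(* at its speed to q + lam * (p - q), lam being the algorithm's (random)     *)
(* choice for that cycle; it immediately starts a new cycle on arrival.      *)
(* If p = q it decides it has gathered and stops forever.                    *)
(* The system is simulated event by event (an event = end of some robot's   *)
(* move, i.e. the start of its next Look).                                   *)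

Section Robots.
Variable R : realType.

(* state of one robot: the current move goes from [orig] to [dest], started *)
(* at some time and ends (next Look) at time [arr]; [cnt] = number of cycles *)
(* already started (index of the next random choice).                        *)
Record rstate := RState {
  orig : R; dest : R; arr : R; stopped : bool; cnt : nat }.

(* position at time t (t between the start of the current move and [arr]) of *)
(* a robot of speed v *)
Definition rpos (v : R) (s : rstate) (t : R) : R :=
  if stopped s then dest s
  else dest s - Num.sg (dest s - orig s) * v * (arr s - t).

Definition act (v : R) (lam : nat -> R) (s : rstate) (p : R) : rstate :=
  let q := dest s in
  let T := arr s in
  if p == q then RState q q T true (cnt s)
  else let l := lam (cnt s) in
       RState q (q + l * (p - q)) (T + `|l| * `|p - q| / v) false (cnt s).+1.

(* process the next event (the earliest pending Look; A first on ties, which *)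
(* is harmless since a robot starting a move at time T is still at its       *)
(* position at time T). *)
Definition step (v w : R) (lamA lamB : nat -> R) (c : rstate * rstate) :
    rstate * rstate :=
  let: (sA, sB) := c in
  if stopped sA && stopped sB then c
  else if ~~ stopped sA && (stopped sB || (arr sA <= arr sB)) then
    (act v lamA sA (rpos w sB (arr sA)), sB)
  else (sA, act w lamB sB (rpos v sA (arr sB))).

Definition init (a0 b0 : R) : rstate * rstate :=
  (RState a0 a0 0 false 0, RState b0 b0 0 false 0).

Definition run (v w a0 b0 : R) (lamA lamB : nat -> R) (n : nat) :=
  iter n (step v w lamA lamB) (init a0 b0).

(* gathering: both robots have (decided they have gathered and) stopped;   *)
(* they are then at the same point. *)
Definition gathers (v w a0 b0 : R) (lamA lamB : nat -> R) : Prop :=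
  exists n, stopped (run v w a0 b0 lamA lamB n).1 &&
            stopped (run v w a0 b0 lamA lamB n).2.

Definition mutually_independent d (T : measurableType d)
    (P : probability T R) (I : eqType) (X : I -> T -> R) : Prop :=
  forall (s : seq I) (B : I -> set R), uniq s ->
    (forall i, measurable (B i)) ->
    P (\bigcap_(i in [set` s]) (X i @^-1` B i)) =
      (\prod_(i <- s) P (X i @^-1` B i))%E.

End Robots.

(* Main.v *)
Require Import Defs.
From HB Require Import structures.
From mathcomp Require Import all_boot all_order all_algebra.
From mathcomp Require Import all_classical all_reals all_analysis.
From mathcomp Require Import measurable_realfun ring lra.
Set Implicit Arguments.
Unset Strict Implicit.
Unset Printing Implicit Defensive.
Import Order.TTheory GRing.Theory Num.Theory.
Local Open Scope ring_scope.
Local Open Scope classical_set_scope.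

(* Fix the factors lambda drawn by both robots, and write the speed ratio as  *)
(* theta / (1 - theta).  As long as nobody has seen the other robot at its    *)
(* own position, all positions and times are, up to a common nonzero scale,   *)
(* polynomials in theta that depend only on the order of the events and on    *)
(* the directions of the moves.  The distance seen at a Look of robot A does  *)
(* not vanish at theta = 1 (B infinitely faster), and the one seen at a Look  *)
(* of B does not vanish at theta = 0; so for each of the countably many       *)
(* histories only finitely many theta produce a meeting.  A family of events  *)
(* such that every outcome lies in finitely many of them has only countably   *)
(* many members of positive probability, so some theta in (0, 1) makes every  *)
(* meeting event null.  The law of an i.i.d. family being unique, that theta  *)
(* serves all probability spaces.                                             *)

(** [step_in_motion] keeps the simulation matched with polynomials whose nonvanishing at 1 and 0 is
    preserved ([perform_nonvanishing]), so gathering forces the factors into one of countably many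
    sets [bad_factors]. A given draw lies in [bad_factors h b theta] for only finitely many theta,
    so by [countable_probability_neq0] each pair [h], [b] excludes countably many theta.
    [iid_law_unique] carries a surviving theta from one reference space to all. *)

Lemma countable_probability_neq0 (R : realType) (d : measure_display)
    (T : measurableType d) (P : probability T R) (E : R -> set T) :
  (forall x, measurable (E x)) -> (forall w, finite_set [set x | E x w]) ->
  countable [set x | P (E x) != 0%E].
Proof.
move=> mE finE.
have -> : [set x | P (E x) != 0%E] =
    \bigcup_(m in @setT nat) [set x | (m.+1%:R^-1%:E <= P (E x))%E].
  apply/seteqP; split=> x /=.
    move=> Px; have P_gt0 : (0 < P (E x))%E by rewrite lt0e Px measure_ge0.
    have Pfin : P (E x) \is a fin_num by exact: fin_num_measure.
    move: P_gt0; rewrite -(fineK Pfin) lte_fin => P_gt0.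
    have := near_infty_natSinv_lt (PosNum P_gt0).
    case=> N _ /(_ N (leqnn _)) /= /ltW HN.
    by exists N => //=; rewrite -(fineK Pfin) lee_fin.
  case=> m _ /= mP; apply/eqP => P0; move: mP.
  by rewrite P0 lee_fin invr_le0 lern0.
apply: bigcup_countable => // m _; apply: finite_set_countable.
(* If infinitely many [E x] had probability at least 1/(m+1), so would their limsup along an
   injective sequence, and some outcome would lie in infinitely many of them. *)
apply: contrapT => /infiniteP infE.
have [f] := @pcard_leP _ (measurableTypeR R) _ _ infE.
pose F n := E (f n).
have mF n : measurable (F n) by exact: mE.
have Pfin : (P (\bigcup_(k in [set k | (0 <= k)%N]) F k) < +oo)%E.
  apply: le_lt_trans (ltry 1); apply: probability_le1.
  by apply: bigcup_measurable => k _; exact: mF.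
have cvgP := lim_sup_set_cvg P F mF Pfin.
have : (m.+1%:R^-1%:E <= P (lim_sup_set F))%E.
  rewrite -(cvg_lim _ cvgP)//; apply: lime_ge.
    by apply/cvg_ex; exists (P (lim_sup_set F)).
  near=> n.
  have /= := @funS _ _ _ _ f n I => /le_trans; apply.
  apply: le_measure; rewrite ?inE //.
    by apply: bigcup_measurable => k _; exact: mF.
  by move=> w Fw; exists n => /=.
have [-> | /set0P[w Hw] _] := eqVneq (lim_sup_set F) set0.
  by rewrite measure0 lee_fin invr_le0 lern0.
have /finite_seqP[s sE] : finite_set [set n | F n w].
  apply: (finite_preimage _ (finE w)) => x y xT yT fxy.
  by apply: (@inj _ _ _ f) => //; rewrite inE.
have [k /= sk Fk] := Hw (\max_(i <- s) i).+1 I.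
have : k \in s by have := congr1 (@^~ k) sE => /= <-.
by move=> /(@leq_bigmax_seq _ _ xpredT id)-/(_ isT); rewrite leqNgt sk.
Unshelve. all: by end_near.
Qed.

Definition cylinders (R : realType) (I : eqType) : set (set (I -> R)) :=
  [set C | exists (s : seq I) (B : I -> set R),
    [/\ uniq s, forall i, measurable (B i) &
    C = \bigcap_(i in [set` s]) ((fun f : I -> R => f i) @^-1` B i)]].

Lemma cylinders_setI (R : realType) (I : eqType) :
  setI_closed (@cylinders R I).
Proof.
move=> _ _ [s1 [B1 [_ mB1 ->]]] [s2 [B2 [_ mB2 ->]]].
exists (undup (s1 ++ s2)), (fun i =>
  (if i \in s1 then B1 i else setT) `&` (if i \in s2 then B2 i else setT)).
split; first exact: undup_uniq.
  by move=> i; apply: measurableI; case: ifP.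
apply/seteqP; split => f /=.
  by move=> [f1 f2] i _ /=; split; case: ifP => // si; [exact: f1|exact: f2].
move=> f12; split => i /= si.
  by have := f12 i; rewrite /= mem_undup mem_cat si => /(_ isT) [].
by have := f12 i; rewrite /= mem_undup mem_cat si orbT => /(_ isT) [].
Qed.

(** Dynkin's pi-lambda argument: the sets on which both laws agree form a lambda-system containing
    the cylinders, where independence gives the same product of values of [mu]. *)
Lemma iid_law_unique (R : realType) (I : eqType) (mu : set R -> \bar R)
    (d1 d2 : measure_display)
    (T1 : measurableType d1) (T2 : measurableType d2)
    (P1 : probability T1 R) (P2 : probability T2 R)
    (X1 : I -> T1 -> R) (X2 : I -> T2 -> R) :
  (forall i, measurable_fun setT (X1 i)) ->
  (forall i, measurable_fun setT (X2 i)) ->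
  (forall i B, measurable B -> P1 (X1 i @^-1` B) = mu B) ->
  (forall i B, measurable B -> P2 (X2 i @^-1` B) = mu B) ->
  mutually_independent P1 X1 -> mutually_independent P2 X2 ->
  forall S : set (I -> R), <<s @cylinders R I >> S ->
  [/\ measurable ((fun w i => X1 i w) @^-1` S),
      measurable ((fun w i => X2 i w) @^-1` S) &
      P1 ((fun w i => X1 i w) @^-1` S) = P2 ((fun w i => X2 i w) @^-1` S)].
Proof.
move=> mX1 mX2 law1 law2 ind1 ind2.
have mpre d (T : measurableType d) (X : I -> T -> R) (s : seq I)
      (B : I -> set R) :
    (forall i, measurable_fun setT (X i)) -> (forall i, measurable (B i)) ->
    measurable (\bigcap_(i in [set` s]) (X i @^-1` B i)).
  move=> mX mB; apply: fin_bigcap_measurable; first exact: finite_seq.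
  move=> i _; rewrite -[_ @^-1` _]setTI; exact: mX.
suff : <<s @cylinders R I >> `<=` [set S |
  [/\ measurable ((fun w i => X1 i w) @^-1` S),
      measurable ((fun w i => X2 i w) @^-1` S) &
      P1 ((fun w i => X1 i w) @^-1` S) = P2 ((fun w i => X2 i w) @^-1` S)]].
  by [].
apply: lambda_system_subset => //; first exact: cylinders_setI.
- apply/dynkin_lambda_system; split.
  + by split; rewrite ?preimage_setT //= !probability_setT.
  + move=> S [m1 m2 e]; split; [exact: measurableC|exact: measurableC|].
    have:= probability_setC P1 m1; rewrite e -(probability_setC P2 m2).
    exact.
  + move=> F tF HF; rewrite /= 2!preimage_bigcup.
    have m1 n : measurable ((fun w i => X1 i w) @^-1` F n) by case: (HF n).
    have m2 n : measurable ((fun w i => X2 i w) @^-1` F n) by case: (HF n).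
    split; try by apply: bigcup_measurable => n _.
    rewrite !measure_bigcup //.
        by apply: eq_eseriesr => n _; case: (HF n).
      by move=> i j _ _ [w [wi wj]]; apply: tF => //; exists (X2 ^~ w).
    by move=> i j _ _ [w [wi wj]]; apply: tF => //; exists (X1 ^~ w).
- move=> _ [s [B [us mB ->]]] /=; rewrite 2!preimage_bigcap.
  split; [exact: mpre|exact: mpre|].
  rewrite (ind1 s B) // (ind2 s B) //.
  by apply: eq_bigr => i _; rewrite law1 // law2.
Qed.

(** * Motion as polynomials in theta *)

(* One robot's current move, as polynomials in theta and up to a scale common *)
(* to both robots: its destination relative to A's initial position, its      *)
(* speed times its arrival time, and whether it heads in the negative         *)
(* direction.                                                                 *)
Record mover (R : realType) := Mover {
  mpos : {poly R}; mtime : {poly R}; msign : bool }.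

(* The offset from [m] to [o] when [m] looks, multiplied by [p] to clear the  *)
(* denominator; [p] and [q] are proportional to the speeds of [m] and [o].    *)
Definition gap (R : realType) (p q : {poly R}) (m o : mover R) : {poly R} :=
  p * (mpos o - (-1) ^+ msign o * mtime o - mpos m) +
  (-1) ^+ msign o * q * mtime m.

Definition advance (R : realType) (p q : {poly R}) (lam : R) (s : bool)
    (m o : mover R) : mover R :=
  Mover (p * mpos m + lam%:P * gap p q m o)
        (p * mtime m + (-1) ^+ s * lam%:P * gap p q m o) s.

Definition rescale (R : realType) (p : {poly R}) (m : mover R) : mover R :=
  Mover (p * mpos m) (p * mtime m) (msign m).

Definition look (R : realType) (b : bool) (c : mover R * mover R) : {poly R} :=
  if b then gap (1 - 'X) 'X c.1 c.2 else gap 'X (1 - 'X) c.2 c.1.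

Definition perform (R : realType) (l : bool * nat -> R) (e : bool * nat * bool)
    (c : mover R * mover R) : mover R * mover R :=
  let: (b, k, s) := e in
  if b then (advance (1 - 'X) 'X (l (true, k)) s c.1 c.2, rescale (1 - 'X) c.2)
  else (rescale 'X c.1, advance 'X (1 - 'X) (l (false, k)) s c.2 c.1).

(* [(i, s, (j, t), es)]: the first nonzero factor is the [i]-th one for A and *)
(* the [j]-th one for B, with directions [s] and [t]; [es] lists the later    *)
(* moves with nonzero factor, latest first, as (is it A, index of the factor, *)
(* direction).                                                                *)
Definition history : Type :=
  (nat * bool * (nat * bool) * seq (bool * nat * bool))%type.

Definition config (R : realType) (l : bool * nat -> R) (h : history) :=
  let: (i, s, (j, t), es) := h in
  foldr (perform l)
    (Mover (l (true, i))%:P ((-1) ^+ s * l (true, i))%:P s,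
     Mover (1 - l (false, j))%:P (- ((-1) ^+ t * l (false, j)))%:P t) es.

Definition nonvanishing (R : realType) (c : mover R * mover R) : Prop :=
  (mtime c.1).[1] != 0 /\ (mtime c.2).[0] != 0.

Definition extend (h : history) (e : bool * nat * bool) : history :=
  (h.1, e :: h.2).

Lemma config_extend (R : realType) (l : bool * nat -> R) (h : history)
    (e : bool * nat * bool) :
  config l (extend h e) = perform l e (config l h).
Proof. by case: h => [[[i s] [j t]] es]. Qed.

(** At theta = 1 the factor [1 - 'X] kills all of A's gap but a signed [mtime] of A; at theta = 0
    the factor ['X] does the same for B. *)
Lemma look_neq0 (R : realType) (b : bool) (c : mover R * mover R) :
  nonvanishing c -> (look b c).[b%:R] != 0.
Proof.
move=> [c1 c2]; rewrite /look /gap; case: b; rewrite !hornerE /=.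
  by rewrite subrr mul0r add0r mulf_neq0 ?signr_eq0.
by rewrite ?mul0r ?add0r ?subr0 ?mulr1 mulf_neq0 ?signr_eq0.
Qed.

(** At its own endpoint, the acting robot's new [mtime] is, up to sign, the factor times the old
    one, and the other robot's is rescaled by 1. *)
Lemma perform_nonvanishing (R : realType) (l : bool * nat -> R)
    (e : bool * nat * bool) (c : mover R * mover R) :
  l e.1 != 0 -> nonvanishing c -> nonvanishing (perform l e c).
Proof.
case: e => -[b k] s /= lk [c1 c2].
case: b lk => lk; split; rewrite /= /gap !hornerE /= ?subrr ?mul0r ?add0r //.
- by rewrite !mulf_neq0 ?signr_eq0.
- by rewrite subr0 mul1r.
- by rewrite subr0 mulr1 !mulf_neq0 ?signr_eq0.
Qed.

(** * Exceptional factors *)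

(** The condition at [b%:R] makes finiteness in theta hold for every [l] and every history, even one
    that no run follows. *)
Definition bad_factors (R : realType) (h : history) (b : bool) (theta : R) :
    set (bool * nat -> R) :=
  [set l | (look b (config l h)).[theta] = 0 /\
           (look b (config l h)).[b%:R] != 0].

Lemma finite_roots (R : idomainType) (p : {poly R}) :
  p != 0 -> finite_set [set x | root p x].
Proof.
apply: contraPP => /infinite_set_fsetP/(_ (size p))[B Bp pB].
rewrite (@roots_geq_poly_eq0 _ p (finmap.enum_fset B)) ?eqxx //.
  by apply/allP => x /Bp.
exact: finmap.fset_uniq.
Qed.

Lemma bad_factors_finite (R : realType) (h : history) (b : bool)
    (l : bool * nat -> R) :
  finite_set [set theta | bad_factors h b theta l].
Proof.
have [l0 | l_neq0] := eqVneq (look b (config l h)) 0.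
  rewrite (_ : mkset _ = set0) //; apply/seteqP; split => // x [_].
  by rewrite l0 horner0 eqxx.
by apply: sub_finite_set (finite_roots l_neq0) => x [/eqP].
Qed.

Lemma measurable_look (R : realType) (d : measure_display)
    (T : measurableType d) (L : bool * nat -> T -> R) (h : history)
    (b : bool) (theta : R) :
  (forall i, measurable_fun setT (L i)) ->
  measurable_fun setT (fun w => (look b (config (L^~ w) h)).[theta]).
Proof.
move=> mL.
(* The history fixes all directions, so they do not vary with the outcome. *)
pose meas (M : T -> mover R) :=
  [/\ measurable_fun setT (fun w => (mpos (M w)).[theta]),
      measurable_fun setT (fun w => (mtime (M w)).[theta]) &
      exists s, forall w, msign (M w) = s].
have mgap p q (M O : T -> mover R) : meas M -> meas O ->
    measurable_fun setT (fun w => (gap p q (M w) (O w)).[theta]).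
  move=> [mx mt _] [ox ot [s os]].
  under eq_fun => w do rewrite /gap os !hornerE.
  apply: measurable_funD; apply: measurable_funM => //.
  apply: measurable_funB => //; apply: measurable_funB => //.
  exact: measurable_funM.
have mresc p (M : T -> mover R) : meas M -> meas (fun w => rescale p (M w)).
  move=> [mx mt ms]; split => //=; under eq_fun => w do rewrite hornerM.
    exact: measurable_funM.
  exact: measurable_funM.
have madv p q i s (M O : T -> mover R) : meas M -> meas O ->
    meas (fun w => advance p q (L i w) s (M w) (O w)).
  move=> mM mO; have mg := mgap p q _ _ mM mO; have [mx mt _] := mM.
  split => /=; last by exists s.
    under eq_fun => w do rewrite hornerD !hornerM hornerC.
    by apply: measurable_funD; apply: measurable_funM.
  under eq_fun => w do rewrite hornerD !hornerM hornerC.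
  apply: measurable_funD; apply: measurable_funM => //.
  exact: measurable_funM.
suff [m1 m2] : meas (fun w => (config (L^~ w) h).1) /\
    meas (fun w => (config (L^~ w) h).2).
  by rewrite /look; case: b; exact: mgap.
case: h => -[[i s] [j t]] es /=.
elim: es => [|[[b' k] s'] es [IH1 IH2]] /=.
  split; split => /=; [| |by exists s| | | by exists t];
    under eq_fun => w do rewrite hornerC.
  - exact: mL.
  - exact: measurable_funM.
  - exact: measurable_funB.
  - by apply: measurable_funN; exact: measurable_funM.
by case: b'; split => /=; [exact: madv|exact: mresc|exact: mresc|exact: madv].
Qed.

(** * Simulated states against polynomials *)

(** In a run, [kappa] is the initial offset divided by the denominators cleared so far; it may be
    negative. *)
Definition represents (R : realType) (theta a kappa u : R) (s : rstate R)
    (m : mover R) : Prop :=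
  [/\ ~~ stopped s, dest s = a + kappa * (mpos m).[theta] &
      u * arr s = kappa * (mtime m).[theta]].

Definition heading (R : realType) (s : rstate R) (m : mover R) : Prop :=
  Num.sg (dest s - orig s) = (-1) ^+ msign m.

Lemma rpos_gap (R : realType) (theta a kappa u w : R) (p q : {poly R})
    (s o : rstate R) (m n : mover R) :
  p.[theta] != 0 -> p.[theta] * w = q.[theta] * u ->
  represents theta a kappa u s m -> represents theta a kappa w o n ->
  heading o n ->
  rpos w o (arr s) - dest s = kappa / p.[theta] * (gap p q m n).[theta].
Proof.
move=> p0 pw [ss ds ts] [so odest otime] ho.
rewrite /rpos (negbTE so) ho odest ds /gap !hornerE.
apply: (mulfI p0); rewrite mulrA [p.[theta] * (kappa / _)]mulrC divfK //.
set r := (-1) ^+ _; set P := p.[theta] in pw *; set Q := q.[theta] in pw *.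
set X := (mpos m).[theta]; set Y := (mpos n).[theta].
have -> : r * w * (arr o - arr s) = r * (w * arr o) - r * w * arr s by ring.
rewrite otime.
transitivity (P * kappa * (Y - r * (mtime n).[theta] - X) +
    r * (P * w) * arr s).
  by ring.
rewrite pw -[r * (Q * u) * _]mulrA -[Q * u * _]mulrA ts; ring.
Qed.

Lemma act_represents (R : realType) (theta a kappa u : R)
    (lam : nat -> R) (p q : {poly R}) (s : rstate R) (m n : mover R) (x : R) :
  0 < u -> p.[theta] != 0 ->
  represents theta a kappa u s m ->
  x - dest s = kappa / p.[theta] * (gap p q m n).[theta] ->
  x != dest s -> lam (cnt s) != 0 ->
  exists e, represents theta a (kappa / p.[theta]) u (act u lam s x)
              (advance p q (lam (cnt s)) e m n) /\
            heading (act u lam s x) (advance p q (lam (cnt s)) e m n).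
Proof.
move=> u0 p0 [ss ds ts] xs xd l0.
set l := lam (cnt s) in l0 *; set de := x - dest s.
have d0 : l * de != 0 by rewrite mulf_neq0 // subr_eq0.
(* With this direction, [(-1) ^+ e * (l * de)] is the length of the move. *)
exists (l * de < 0); rewrite /act (negbTE xd) -/l; split; last first.
  by rewrite /heading /= addrC addKr sgr_def d0 mulr1n.
rewrite /advance; move: (gap p q m n) xs => G xs.
split => //=.
  rewrite xs ds !(hornerD, hornerM, hornerC).
  by field.
rewrite mulrDr ts mulrCA divff ?gt_eqF // mulr1 -normrM -/de.
rewrite normrEsg sgr_def d0 mulr1n {2}/de xs.
rewrite !(hornerD, hornerM, hornerC).
by case: (_ < 0); rewrite ?(expr0, expr1, hornerN, hornerC); field.
Qed.

Lemma rescale_represents (R : realType) (theta a kappa u : R) (p : {poly R})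
    (s : rstate R) (m : mover R) :
  p.[theta] != 0 -> represents theta a kappa u s m ->
  represents theta a (kappa / p.[theta]) u s (rescale p m).
Proof.
move=> p0 [ss ds ts]; split => //=.
  by rewrite ds hornerM; field.
by rewrite ts hornerM; field.
Qed.

Lemma act0_represents (R : realType) (theta a kappa u x : R)
    (lam : nat -> R) (s : rstate R) (m : mover R) :
  represents theta a kappa u s m -> x != dest s -> lam (cnt s) = 0 ->
  represents theta a kappa u (act u lam s x) m /\
  arr (act u lam s x) = arr s.
Proof.
move=> [ss ds ts] xd l0; rewrite /act (negbTE xd) l0 normr0 !mul0r !addr0.
by split.
Qed.

(** * Runs outside the exceptional factors *)

Section trajectories.
Variables (R : realType) (theta v a0 b0 : R) (l : bool * nat -> R).
Hypotheses (theta_gt0 : 0 < theta) (theta_lt1 : theta < 1) (v_gt0 : 0 < v).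
Hypothesis a0_neq_b0 : a0 != b0.
Hypothesis l_good : forall h b, ~ bad_factors h b theta l.

Let w := theta / (1 - theta) * v.
Let lamA k := l (true, k).
Let lamB k := l (false, k).

Definition start (x : R) (k : nat) : rstate R := RState x x 0 false k.

(* A robot that has just drawn the factor 0 has no heading, but it looks      *)
(* again before the other robot does, so its heading is never read.           *)
Definition in_motion (c : rstate R * rstate R) : Prop :=
  exists h kappa, [/\ kappa != 0, nonvanishing (config l h),
    represents theta a0 kappa v c.1 (config l h).1,
    represents theta a0 kappa w c.2 (config l h).2 &
    (heading c.1 (config l h).1 \/ arr c.1 <= arr c.2) /\
    (heading c.2 (config l h).2 \/ arr c.2 < arr c.1)].

(** Since factors may be 0, time 0 has two preliminary stages: A has drawn only zeros; then A is
    leaving while B has drawn only zeros. *)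
Definition reachable (c : rstate R * rstate R) : Prop :=
  [\/ exists i j, c = (start a0 i, start b0 j),
      exists i j, lamA i != 0 /\ c = (act v lamA (start a0 i) b0, start b0 j) |
      in_motion c].

Let w_gt0 : 0 < w.
Proof. by rewrite /w !mulr_gt0 // invr_gt0 subr_gt0. Qed.

Let speedA : (1 - 'X : {poly R}).[theta] * w = ('X : {poly R}).[theta] * v.
Proof.
rewrite !(hornerD, hornerN, hornerX, hornerC) /w; field.
by rewrite subr_eq0 eq_sym lt_eqF.
Qed.

Let speedA0 : (1 - 'X : {poly R}).[theta] != 0.
Proof. by rewrite !hornerE subr_eq0 eq_sym lt_eqF. Qed.

Let speedB0 : ('X : {poly R}).[theta] != 0.
Proof. by rewrite !hornerE gt_eqF. Qed.

Lemma look_in_motion_neq0 (h : history) (b : bool) :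
  nonvanishing (config l h) -> (look b (config l h)).[theta] != 0.
Proof.
move=> nd; apply/eqP => look0; apply: (@l_good h b); split => //.
exact: look_neq0.
Qed.

Lemma step_start (i j : nat) :
  reachable (step v w lamA lamB (start a0 i, start b0 j)).
Proof.
rewrite /step /= lexx /= /rpos /= subrr sgr0 !mul0r subr0.
have [l0 | l0] := eqVneq (lamA i) 0.
  apply: Or31; exists i.+1, j.
  rewrite /act /= eq_sym (negbTE a0_neq_b0) l0 /start.
  by rewrite normr0 !mul0r !addr0.
by apply: Or32; exists i, j.
Qed.

Lemma step_second_start (i j : nat) : lamA i != 0 ->
  reachable (step v w lamA lamB (act v lamA (start a0 i) b0, start b0 j)).
Proof.
move=> li.
have d0 : b0 - a0 != 0 by rewrite subr_eq0 eq_sym.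
have arr_gt0 : 0 < `|lamA i| * `|b0 - a0| / v.
  by rewrite divr_gt0 // mulr_gt0 // normr_gt0.
have actA : act v lamA (start a0 i) b0 =
    RState a0 (a0 + lamA i * (b0 - a0)) (`|lamA i| * `|b0 - a0| / v) false i.+1.
  by rewrite /act /= eq_sym (negbTE a0_neq_b0) add0r.
have ld0 : lamA i * (b0 - a0) != 0 by rewrite mulf_neq0.
have vdiv x : v * (x / v) = x by rewrite mulrCA divff ?mulr1 // gt_eqF.
have wdiv x : w * (x / w) = x by rewrite mulrCA divff ?mulr1 // gt_eqF.
rewrite actA /step /= leNgt arr_gt0 /=.
(* B looks at time 0, when A is still at [a0]. *)
have -> : rpos v (RState a0 (a0 + lamA i * (b0 - a0))
    (`|lamA i| * `|b0 - a0| / v) false i.+1) 0 = a0.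
  rewrite /rpos /= subr0 [a0 + _ - a0]addrC addKr -mulrA vdiv -normrM.
  by rewrite -numEsg addrK.
rewrite /act /= (negbTE a0_neq_b0).
have [lj | lj] := eqVneq (lamB j) 0.
  apply: Or32; exists i, j.+1; split => //.
  by rewrite lj normr0 !mul0r !addr0 -actA.
have ld0' : lamB j * (a0 - b0) != 0 by rewrite mulf_neq0 // subr_eq0.
apply: Or33; exists (i, lamA i * (b0 - a0) < 0,
  (j, lamB j * (a0 - b0) < 0), [::]), (b0 - a0); split => //=.
- split; rewrite /= hornerC ?mulf_neq0 ?signr_eq0 //.
  by rewrite oppr_eq0 mulf_neq0 ?signr_eq0.
- split => //=; rewrite hornerC; first by rewrite mulrC.
  by rewrite vdiv -normrM normrEsign -/(lamA i); ring.
- split => //=; rewrite hornerC; first by rewrite -/(lamB j); ring.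
  by rewrite add0r wdiv -normrM normrEsign -/(lamB j); ring.
split; left; rewrite /heading /= [_ + _ * _ - _]addrC addKr.
  by rewrite sgr_def ld0 mulr1n.
by rewrite sgr_def ld0' mulr1n.
Qed.

Lemma step_in_motion (c : rstate R * rstate R) :
  in_motion c -> reachable (step v w lamA lamB c).
Proof.
case: c => sA sB [h [kappa]]; set m := config l h => /=.
move=> [kappa0 nd repA repB [headA headB]].
have [nsA _ _] := repA; have [nsB _ _] := repB.
rewrite /step (negbTE nsA) (negbTE nsB) /=; apply: Or33.
case: ltP headA headB => [arrBA|arrAB] headA headB.
  have {}headA : heading sA m.1 by case: headA.
  have xs := rpos_gap speedB0 (esym speedA) repB repA headA.
  have xd : rpos v sA (arr sB) != dest sB.
    rewrite -subr_eq0 xs !mulf_neq0 ?invr_eq0 //.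
    exact: (look_in_motion_neq0 false nd).
  have [l0 | l0] := eqVneq (lamB (cnt sB)) 0.
    have [rep' arr'] := act0_represents repB xd l0.
    by exists h, kappa; split => //=; rewrite arr'; split; [left|right].
  have [e [rep' head']] := act_represents w_gt0 speedB0 repB xs xd l0.
  exists (extend h (false, cnt sB, e)), (kappa / ('X : {poly R}).[theta]).
  rewrite config_extend; split => //=.
  - by rewrite mulf_neq0 ?invr_eq0.
  - exact: (@perform_nonvanishing _ l (false, cnt sB, e)).
  - exact: rescale_represents.
  - by split; left.
have {}headB : heading sB m.2.
  by case: headB => //; rewrite ltNge arrAB.
have xs := rpos_gap speedA0 speedA repA repB headB.
have xd : rpos w sB (arr sA) != dest sA.
  rewrite -subr_eq0 xs !mulf_neq0 ?invr_eq0 //.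
  exact: (look_in_motion_neq0 true nd).
have [l0 | l0] := eqVneq (lamA (cnt sA)) 0.
  have [rep' arr'] := act0_represents repA xd l0.
  by exists h, kappa; split => //=; rewrite arr'; split; [right|left].
have [e [rep' head']] := act_represents v_gt0 speedA0 repA xs xd l0.
exists (extend h (true, cnt sA, e)),
  (kappa / (1 - 'X : {poly R}).[theta]).
rewrite config_extend; split => //=.
- by rewrite mulf_neq0 ?invr_eq0.
- exact: (@perform_nonvanishing _ l (true, cnt sA, e)).
- exact: rescale_represents.
- by split; left.
Qed.

(** Every reachable state has a robot that has not stopped. *)
Lemma not_gathers : ~ gathers v w a0 b0 lamA lamB.
Proof.
have reach n : reachable (run v w a0 b0 lamA lamB n).
  elim: n => [|n]; first by apply: Or31; exists 0, 0.
  rewrite /run iterS; case=> [[i [j ->]]|[i [j [li ->]]]|].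
  - exact: step_start.
  - exact: step_second_start.
  - exact: step_in_motion.
case=> n /andP[]; case: (reach n) => [[i [j ->]]|[i [j [_ ->]]]|] //.
by move=> [h [kappa [_ _ [/negbTE ->]]]].
Qed.

End trajectories.

(** * Choice of the speed ratio *)

Lemma bad_factors_cylinder (R : realType) (h : history) (b : bool)
    (theta : R) :
  <<s @cylinders R (bool * nat)%type >> (bad_factors h b theta).
Proof.
pose T := @g_sigma_algebraType ((bool * nat)%type -> measurableTypeR R)
  (@cylinders R (bool * nat)%type).
have mcoord i : measurable_fun setT (fun f : T => f i).
  move=> _ B mB; rewrite setTI; apply: sub_sigma_algebra.
  exists [:: i], (fun=> B); split => //; apply/seteqP; split => f /=.
    by move=> fB j; rewrite /= inE => /eqP ->.
  by apply; rewrite /= inE.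
suff : measurable (bad_factors h b theta : set T) by [].
rewrite (_ : bad_factors h b theta =
    [set l | (look b (config l h)).[theta] = 0] `&`
    ~` [set l | (look b (config l h)).[b%:R] = 0]); last first.
  by apply/seteqP; split => l [l1 l2]; split => //; apply/eqP.
have mlook x : measurable ([set l | (look b (config l h)).[x] = 0] : set T).
  have := measurable_look h b x mcoord measurableT (measurable_set1 0).
  by rewrite setTI.
by apply: measurableI => //; exact: measurableC.
Qed.

Lemma negligible_bigcup_count (R : realType) (d : measure_display)
    (T : measurableType d) (P : probability T R) (I : countType)
    (F : I -> set T) :
  (forall i, P.-negligible (F i)) -> P.-negligible (\bigcup_i F i).
Proof.
move=> negF; pose G n := if unpickle n is Some i then F i else set0.
have : P.-negligible (\bigcup_n G n).
  apply: negligible_bigcup => n; rewrite /G; case: unpickle => [i|].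
    exact: negF.
  exact: negligible_set0.
apply: negligibleS => w [i _ Fiw]; exists (pickle i) => //.
by rewrite /G pickleK.
Qed.

Lemma exists_itv01_notin (R : realType) (A : set R) :
  countable A -> exists2 x, 0 < x < 1 & ~ A x.
Proof.
move=> cA; apply: contrapT => noex.
(* The unit interval has Lebesgue measure 1, a countable set measure 0. *)
have sub : `]0, 1[%classic `<=` A.
  move=> x /=; rewrite in_itv /= => x01; apply: contrapT => nAx.
  by apply: noex; exists x.
have : lebesgue_measure (`]0, 1[%classic : set R) = 0%E.
  exact/countable_lebesgue_measure0/(sub_countable (subset_card_le sub)).
rewrite lebesgue_measure_itv /= lte_fin ltr01 oppr0 adde0 => /eqP.
by rewrite eqe oner_eq0.
Qed.

Theorem theorem3 (R : realType) (mu : probability R R) :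
  exists alpha : R, 0 < alpha /\
  forall (v a0 b0 : R), 0 < v -> a0 != b0 ->
  forall (d : measure_display) (T : measurableType d) (P : probability T R)
         (L : bool -> nat -> T -> R),
    (forall b k, measurable_fun setT (L b k)) ->
    (forall b k (B : set R), measurable B -> P (L b k @^-1` B) = mu B) ->
    mutually_independent P (fun i : bool * nat => L i.1 i.2) ->
    P.-negligible
      [set w | gathers v (alpha * v) a0 b0 (fun k => L true k w)
                                            (fun k => L false k w)].
Proof.
pose iid d (T : measurableType d) (P : probability T R)
    (X : bool * nat -> T -> R) :=
  [/\ forall i, measurable_fun setT (X i),
      forall i (B : set R), measurable B -> P (X i @^-1` B) = mu B &
      mutually_independent P X].
(* The ratio must precede the probability space, so it is chosen on one reference family; if there
   is none, the claim is vacuous. *)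
have [[d0 [T0 [P0 [X0 [mX0 lawX0 indX0]]]]]|no_iid] :=
    pselect (exists d (T : measurableType d) (P : probability T R) X,
      iid d T P X); last first.
  exists 1; split => // v a0 b0 _ _ d T P L mL lawL indL.
  exfalso; apply: no_iid.
  exists d, T, P, (fun i => L i.1 i.2).
  by split => // i; exact: lawL.
pose E (c : history * bool) theta :=
  (fun w i => X0 i w) @^-1` bad_factors c.1 c.2 theta.
have cE : countable (\bigcup_(c in @setT (history * bool))
    [set theta | P0 (E c theta) != 0%E]).
  apply: bigcup_countable => [|c _]; first exact: countableP.
  apply: countable_probability_neq0.
    move=> theta; have cyl := bad_factors_cylinder c.1 c.2 theta.
    by case: (iid_law_unique mX0 mX0 lawX0 lawX0 indX0 indX0 cyl).
  by move=> w; exact: bad_factors_finite.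
have [theta /andP[theta_gt0 theta_lt1] theta_good] :=
  exists_itv01_notin cE.
exists (theta / (1 - theta)); split; first by rewrite divr_gt0 // subr_gt0.
move=> v a0 b0 v_gt0 ab d T P L mL lawL indL.
pose X (i : bool * nat) := L i.1 i.2.
have mX i : measurable_fun setT (X i) by exact: mL.
have lawX i (B : set R) : measurable B -> P (X i @^-1` B) = mu B by exact: lawL.
pose F c := (fun w i => X i w) @^-1` bad_factors c.1 c.2 theta.
have negF (c : history * bool) : P.-negligible (F c).
  have cyl := bad_factors_cylinder c.1 c.2 theta.
  have [mF _ PF] := iid_law_unique mX mX0 lawX lawX0 indL indX0 cyl.
  apply/negligibleP => //; apply: (eq_trans PF).
  apply: contrapT => /eqP PE.
  by apply: theta_good; exists c.
have := negligible_bigcup_count negF; apply: negligibleS.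
move=> w; apply: contraPP => nF.
apply: (@not_gathers _ theta v a0 b0 (fun i => X i w)) => // h b bad.
by apply: nF; exists (h, b).
Qed.
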